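(* For any integer $n \geq 2$, the cardinality $|\operatorname{Gr}_{2,n}^{\geq 0}(\mathbb{F}_5)|$ is equal to each of the following three expressions: $$\sum_{1 \leq i < j \leq n} 3^{j-i-1} 5^{n-j} + \sum_{1 \leq i < j < \ell \leq n} 4 \cdot 3^{j-i-1} 5^{\ell-j-1} 7^{n-\ell},$$ $$\frac{2\cdot 7^n - 3 \cdot 5^n + 1}{24},$$ $$[x^{n-2}] \left(\frac{1}{(1-x)(1-5x)(1-7x)}\right).$$
   Context: $\mathbb{F}_q$ is the finite field with $q$ elements. For $a \in \mathbb{F}_q$, write $a \geq 0$ if $a = x^2$ for some $x \in \mathbb{F}_q$; thus in $\mathbb{F}_5$ the nonnegative elements are $0, 1, 4$. $\operatorname{Gr}_{k,n}(\mathbb{F}_q)$ is the set of $k$-dimensional subspaces of $\mathbb{F}_q^n$. For a full rank $k \times n$ matrix $A$, $[A]$ denotes its row span, and for a $k$-element subset $I$ of $[n]=\{1,\dots,n\}$, $\Delta_I(A)$ is the $k \times k$ minor of $A$ using the columns indexed by $I$ (in increasing order). The totally nonnegative finite Grassmannian is $$\operatorname{Gr}_{k,n}^{\geq 0}(\mathbb{F}_q) = \{V \in \operatorname{Gr}_{k,n}(\mathbb{F}_q) : \text{there is a matrix } A \text{ with } [A] = V \text{ and } \Delta_I(A) \geq 0 \text{ for all } k\text{-element } I \subseteq [n]\}.$$ $[x^m](f(x))$ denotes the coefficient of $x^m$ in the formal power series $f(x)$. *)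

(* Defs.v *)
From HB Require Import structures.
From mathcomp Require Import all_boot all_order all_algebra.

Set Implicit Arguments.
Unset Strict Implicit.
Unset Printing Implicit Defensive.

Import Order.TTheory GRing.Theory Num.Theory.
Local Open Scope ring_scope.

(* The subtype structure of {vspace vT} over matrices is only visible after
   this import. *)
Import VectorInternalTheory.

HB.instance Definition _ (F : finFieldType) (vT : vectType F) :=
  [Countable of {vspace vT} by <:].
HB.instance Definition _ (F : finFieldType) (vT : vectType F) :=
  [Finite of {vspace vT} by <:].

Definition nonneg (F : finFieldType) (a : F) : bool := [exists x : F, a == x ^+ 2].

Definition Gr (F : finFieldType) (k n : nat) : {set {vspace 'rV[F]_n}} :=
  [set V : {vspace 'rV[F]_n} | (\dim V == k)%N].

Definition rowspan (F : finFieldType) (k n : nat) (A : 'M[F]_(k, n)) :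
  {vspace 'rV[F]_n} := <<[seq row i A | i : 'I_k]>>%VS.

Definition ksubset (k n : nat) : finType := {I : {set 'I_n} | #|I| == k}.

(* [enum_val] lists the elements of [val I] in increasing order. *)
Definition ksubset_nth (k n : nat) (I : ksubset k n) (j : 'I_k) : 'I_n :=
  enum_val (cast_ord (esym (eqP (valP I))) j).

Lemma ksubset_nth_lt (k n : nat) (I : ksubset k n) (i j : 'I_k) :
  (i < j)%N -> (ksubset_nth I i < ksubset_nth I j)%N.
Proof.
move=> ltij; rewrite /ksubset_nth.
set a := cast_ord _ i; set b := cast_ord _ j.
have srt : sorted ltn (map val (enum (val I))).
  rewrite -[enum _](eq_filter (mem_enum _)).
  rewrite -(eq_filter (mem_map val_inj _)) -filter_map.
  by rewrite (sorted_filter ltn_trans) // unlock val_ord_enum iota_ltn_sorted.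
have sz (c : 'I_#|val I|) : (c < size (map val (enum (val I))))%N.
  by rewrite size_map -cardE.
have := sorted_ltn_nth ltn_trans 0%N srt a b (sz a) (sz b) ltij.
have nthE (c : 'I_#|val I|) :
    nth 0%N (map val (enum (val I))) c = enum_val c :> nat.
  by rewrite (nth_map (enum_default c)) -?cardE.
by rewrite !nthE.
Qed.

Definition minor (F : finFieldType) (k n : nat) (I : ksubset k n)
  (A : 'M[F]_(k, n)) : F := \det (colsub (ksubset_nth I) A).

Definition Gr_nonneg (F : finFieldType) (k n : nat) : {set {vspace 'rV[F]_n}} :=
  [set V in Gr F k n | [exists A : 'M[F]_(k, n),
     [&& row_free A, rowspan A == V & [forall I : ksubset k n, nonneg (minor I A)]]]].

(* A formal power series is its sequence of coefficients, so that the
   coefficient of x^m in f is f m. *)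
Definition fps (R : nzRingType) : Type := nat -> R.

Definition fps_of_poly (R : nzRingType) (p : {poly R}) : fps R := fun m => p`_m.

Definition fps_mul (R : nzRingType) (f g : fps R) : fps R :=
  fun m => \sum_(i < m.+1) f i * g (m - i)%N.

Fixpoint fps_inv_coefs (R : fieldType) (f : fps R) (m : nat) : seq R :=
  if m is m'.+1 then
    let s := fps_inv_coefs f m' in
    rcons s (((m' == 0)%N%:R - \sum_(i < m') s`_i * f (m' - i)%N) / f 0)
  else [::].

(* The multiplicative inverse of f, meaningful only when f 0 != 0. *)
Definition fps_inv (R : fieldType) (f : fps R) : fps R :=
  fun m => (fps_inv_coefs f m.+1)`_m.

Lemma size_fps_inv_coefs (R : fieldType) (f : fps R) (m : nat) :
  size (fps_inv_coefs f m) = m.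
Proof. by elim: m => //= m IH; rewrite size_rcons IH. Qed.

Lemma nth_fps_inv_coefs (R : fieldType) (f : fps R) (m i : nat) :
  (i < m)%N -> (fps_inv_coefs f m)`_i = fps_inv f i.
Proof.
elim: m => // m IH; rewrite ltnS leq_eqVlt => /orP[/eqP->//|lim].
by rewrite /= nth_rcons size_fps_inv_coefs lim IH.
Qed.

Lemma fps_mulVf (R : fieldType) (f : fps R) (f0 : f 0%N != 0) (m : nat) :
  fps_mul (fps_inv f) f m = (m == 0)%N%:R.
Proof.
rewrite /fps_mul big_ord_recr /= subnn.
rewrite {2}/fps_inv /= nth_rcons size_fps_inv_coefs ltnn eqxx divfK //.
rewrite [X in _ + (_ - X)](eq_bigr (fun i : 'I_m => fps_inv f i * f (m - i)%N)).
  by rewrite addrC subrK.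
by move=> i _; rewrite nth_fps_inv_coefs.
Qed.

(* Main.v *)
Require Import Defs.
From mathcomp Require Import all_boot all_order all_algebra.
From mathcomp Require Import zify ring lra.

Import GRing.Theory Num.Theory.
Local Open Scope ring_scope.

(** In the field with five elements the squares are 0, 1 and -1, so a plane is
    totally nonnegative when one of its bases has all 2 x 2 minors in {0, 1, -1}.
    Up to sign the nonzero vectors of the plane F_5^2 are 12 points.  Join two of
    them when their determinant is 1 or -1: the result is the icosahedron, with 30
    edges and 20 triangles, and four points are never pairwise joined.  Hence the
    columns of a nonnegative matrix of full rank are, up to sign and apart from
    zero columns, the vertices of an edge or of a triangle.

    The closed formula comes from comparing the matrices whose columns all lie in
    {0, +-e1, +-e2, +-(e1 + e2)} (a triangle, 7 vectors) with those whose columns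
    all lie in {0, +-e1, +-e2} (an edge, 5 vectors).  Fix a nonnegative plane V.  If
    the columns of its nonnegative bases are the vertices of an edge, then 24 bases
    of V have all columns in the triangle and 8 in the edge; if they are the vertices
    of a triangle, then the numbers are 12 and 0.  In both cases

      2 * (bases of V in the triangle) - 3 * (bases of V in the edge) = 24

    ([fibre_balance]).  Conversely every matrix of full rank in the triangle spans
    a nonnegative plane ([card_full_rank]).  There are 7^n matrices in the triangle
    and 5^n in the edge, and those of rank at most one lie on a single line, which
    makes 3 (3^n - 1) + 1 and 2 (3^n - 1) + 1 of them ([card_degenerate]).  In the
    combination above the powers of 3 cancel, which gives
    24 |Gr| = 2 * 7^n - 3 * 5^n + 1 ([card_Gr_nonneg]).

    The double and triple sums satisfy linear recurrences in n that determine their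
    closed forms ([sum_edges], [sum_triangles]).  For the generating function, an
    inverse series is unique ([fps_inv_uniq]), so it suffices that the closed
    formula is annihilated by the recurrence with characteristic roots 1, 5 and 7
    ([fps_inv_cubic]). *)

Set Implicit Arguments.
Unset Strict Implicit.

(** * Row spans and their bases *)

Section RowSpan.
Variables (F : finFieldType) (k n : nat).
Implicit Types A B : 'M[F]_(k, n).

Lemma memv_rowspan A (v : 'rV[F]_n) : (v \in rowspan A) = (v <= A)%MS.
Proof.
apply/idP/idP => [/coord_span->|/submxP[u ->]].
  apply: summx_sub => i _; apply: scalemx_sub.
  have /imageP[j _ ->] : [seq row i A | i : 'I_k]`_i \in [seq row i A | i : 'I_k].
    by apply: mem_nth; case: i => i /= lti; rewrite size_tuple.
  exact: row_sub.
rewrite mulmx_sum_row; apply: memv_suml => i _; apply: memvZ.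
by apply: memv_span; apply: image_f.
Qed.

Lemma eq_rowspan A B : (rowspan A == rowspan B) = (A == B)%MS.
Proof.
apply/eqP/eqmxP => [eqAB|eqAB]; last first.
  by apply/vspaceP => v; rewrite !memv_rowspan eqAB.
by apply/eqmxP/andP; split; apply/row_subP=> i; rewrite -memv_rowspan;
   [rewrite -eqAB|rewrite eqAB]; rewrite memv_rowspan row_sub.
Qed.

Lemma dim_rowspan A : row_free A -> \dim (rowspan A) = k.
Proof.
move=> freeA.
have szA : size [seq row i A | i : 'I_k] = k by rewrite size_map size_enum_ord.
rewrite -[RHS]szA; apply/eqP; rewrite -[_ == _]/(free _).
have -> : [seq row i A | i : 'I_k] = [tuple row i A | i < k].
  by [].
apply/freeP => c c0 i.
have : (\row_j c j) *m A == 0.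
  rewrite mulmx_sum_row -[X in _ == X]c0; apply/eqP; apply: eq_bigr => j _.
  by rewrite mxE -tnth_nth tnth_mktuple.
by rewrite mulmx_free_eq0 // => /eqP/rowP/(_ i); rewrite !mxE.
Qed.

(** The bases of a fixed subspace form a single free orbit of the general linear
    group, so they are counted by the invertible matrices. *)
Lemma card_rowspan_fibre A (P : pred 'M[F]_(k, n)) : row_free A ->
  #|[set B | row_free B & (rowspan B == rowspan A) && P B]| =
  #|[set g : 'M[F]_k | g \in unitmx & P (g *m A)]|.
Proof.
move=> freeA; rewrite -[RHS](card_imset _ (row_free_inj freeA)).
apply: eq_card => B; rewrite inE; apply/idP/imsetP => [|[g]].
  case/and3P=> freeB; rewrite eq_rowspan => /andP[/submxP[g defB] _] PB.
  rewrite {}defB in freeB PB *.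
  exists g => //; rewrite inE PB andbT -row_free_unit /row_free eqn_leq rank_leq_row.
  by rewrite -[X in (X <= _)%N](eqP freeB) mxrankM_maxl.
rewrite inE => /andP[Ug PgA] ->; rewrite PgA andbT eq_rowspan.
have eqA : (g *m A :=: A)%MS.
  by apply: eqmxMfull; rewrite row_full_unit.
by rewrite /row_free eqA; apply/andP; split=> //; apply/eqmxP.
Qed.

End RowSpan.

(** * Matrices with two rows *)

Definition column {F : finFieldType} {n : nat} (A : 'M[F]_(2, n)) (j : 'I_n) : F * F :=
  (A 0 j, A 1 j).

Definition det2 {F : finFieldType} (p q : F * F) : F := p.1 * q.2 - q.1 * p.2.

Definition act {F : finFieldType} (g : 'M[F]_2) (p : F * F) : F * F :=
  (g 0 0 * p.1 + g 0 1 * p.2, g 1 0 * p.1 + g 1 1 * p.2).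

Section TwoRows.
Variables (F : finFieldType) (n : nat).
Implicit Types (A : 'M[F]_(2, n)) (p q u : F * F) (U : seq (F * F)).

Definition pick2 {T : Type} (i j : T) (k : 'I_2) : T := if k == 0 then i else j.

Lemma det_colsub2 (f : 'I_2 -> 'I_n) A :
  \det (colsub f A) = det2 (column A (f 0)) (column A (f 1)).
Proof.
rewrite (expand_det_row _ 0) !big_ord_recl big_ord0 addr0 /cofactor !det_mx11 !mxE /=.
rewrite /det2 /= expr0 expr1 !mul1r mulN1r mulrN.
have -> : lift 0 0 = 1 :> 'I_2 by apply/val_inj.
by have -> : lift 1 0 = 0 :> 'I_2 by apply/val_inj.
Qed.

Lemma det2_pp p : det2 p p = 0.
Proof. by rewrite /det2 subrr. Qed.

Lemma det2_swap p q : det2 q p = - det2 p q.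
Proof. by rewrite /det2 opprB. Qed.

Lemma det2_mulmx (g : 'M_2) A i j :
  det2 (column (g *m A) i) (column (g *m A) j) =
  \det g * det2 (column A i) (column A j).
Proof.
have detE (B : 'M[F]_(2, n)) :
    det2 (column B i) (column B j) = \det (colsub (pick2 i j) B).
  by rewrite det_colsub2.
by rewrite !detE -mulmx_colsub det_mulmx.
Qed.

Lemma column_mulmx (g : 'M_2) A j : column (g *m A) j = act g (column A j).
Proof.
rewrite /column /act !mxE !big_ord_recl !big_ord0 !addr0 /=.
by have -> : lift 0 0 = 1 :> 'I_2 by apply/val_inj.
Qed.

Lemma row_free2P A :
  reflect (exists i j, det2 (column A i) (column A j) != 0) (row_free A).
Proof.
apply: (iffP idP) => [freeA|[i [j]]].
  have fullA : row_full A^T by rewrite /row_full mxrank_tr.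
  have := fullrowsub_unit fullA; rewrite -unitmx_tr trmx_mxsub trmxK.
  rewrite unitmxE unitfE det_colsub2 => ne0.
  by do 2 eexists; exact: ne0.
rewrite -[column A i]/(column A (pick2 i j 0)).
rewrite -[column A j]/(column A (pick2 i j 1)).
rewrite -det_colsub2 -unitfE -unitmxE -row_free_unit => /eqP rk2.
rewrite /row_free eqn_leq rank_leq_row -[X in (X <= _)%N]rk2 -[A in colsub _ A]mulmx1.
by rewrite -mulmx_colsub mxrankM_maxl.
Qed.

(** A minor changes only its sign when its columns are swapped, so if nonnegativity
    ignores signs, then it may be tested on ordered pairs of columns. *)
Lemma forall_minor2 A : (forall a : F, nonneg (- a) = nonneg a) ->
  [forall I : ksubset 2 n, nonneg (minor I A)] =
  [forall i, forall j, nonneg (det2 (column A i) (column A j))].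
Proof.
move=> nonnegN; apply/forallP/forallP => [pos i|pos I]; last first.
  by rewrite /minor det_colsub2; have /forallP := pos (ksubset_nth I 0); apply.
apply/forallP=> j; have [->|neij] := eqVneq i j.
  by rewrite det2_pp; apply/existsP; exists 0; rewrite expr0n.
have card_ij : #|[set i; j]| == 2 by rewrite cards2 neij.
(* The columns that [I] selects are i and j; their order only affects the sign. *)
set I : ksubset 2 n := Sub [set i; j] card_ij.
have inI k : ksubset_nth I k \in [set i; j] by exact: enum_valP.
have := pos I; rewrite /minor det_colsub2.
have := ksubset_nth_lt I (i := 0) (j := 1) isT.
have := inI 0; have := inI 1; rewrite !inE.
by do 2 case/orP=> /eqP->; rewrite ?ltnn // det2_swap nonnegN.
Qed.

(** [star U] is {0} together with the vectors of [U] up to sign.  A list rather than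
    a set, so that membership can be evaluated. *)
Definition star U : seq (F * F) := 0 :: U ++ [seq - u | u <- U].
Definition columns_in (S : seq (F * F)) A := [forall j, column A j \in S].

Lemma mem_star U p : (p \in star U) = [|| p == 0, p \in U | - p \in U].
Proof.
rewrite inE mem_cat; congr [|| _, _ | _].
by rewrite -{1}[p]opprK mem_map //; exact: oppr_inj.
Qed.

Lemma card_columns_in (S : seq (F * F)) : uniq S ->
  #|[set A | columns_in S A]| = (size S ^ n)%N.
Proof.
move=> uniqS.
rewrite -(card_uniqP uniqS) -[in RHS](card_ord n) -card_ffun_on.
pose cols A := [ffun j => column A j].
pose mx (c : {ffun 'I_n -> F * F}) : 'M_(2, n) :=
  \matrix_(i, j) if i == 0 then (c j).1 else (c j).2.
have colsK : cancel cols mx.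
  move=> A; apply/matrixP => i j; rewrite mxE ffunE /=.
  by case: i => [[|[|//]] lti]; congr (A _ j); apply/val_inj.
have mxK : cancel mx cols.
  by move=> c; apply/ffunP => j; rewrite ffunE /column !mxE /=; case: (c j).
rewrite -(card_imset _ (can_inj colsK)); apply: eq_card => c.
rewrite -[c]mxK (mem_imset _ _ (can_inj colsK)) inE.
apply/forallP/ffun_onP => h j; have := h j; by rewrite ffunE.
Qed.

Lemma det2Nl p q : det2 (- p) q = - det2 p q.
Proof. by rewrite /det2 /= mulrN mulNr opprB opprK addrC. Qed.

Lemma det20l p : det2 0 p = 0.
Proof. by rewrite /det2 mul0r mulr0 subr0. Qed.

Lemma star1P u p : reflect [\/ p = 0, p = u | p = - u] (p \in star [:: u]).
Proof.
rewrite mem_star !inE eqr_oppLR; apply: (iffP or3P).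
  by case=> /eqP; [apply: Or31|apply: Or32|apply: Or33].
by case=> ->; [apply: Or31|apply: Or32|apply: Or33].
Qed.

Lemma uniq_star1 U u : uniq (star U) -> u \in U -> uniq (star [:: u]).
Proof.
rewrite {1}/star cons_uniq cat_uniq mem_cat negb_or.
case/andP=> /andP[U0 _] /and3P[_ disj _] Uu.
have u0 : u != 0 by apply: contraNneq U0 => <-.
have uN : u != - u.
  apply: contraNneq disj => uN; apply/hasP; exists u => //.
  by rewrite uN map_f.
by rewrite /= !inE negb_or eq_sym u0 eq_sym oppr_eq0 u0 uN.
Qed.

Lemma columns_in0 A : columns_in (star [::]) A = [forall j, column A j == 0].
Proof. by apply: eq_forallb => j; rewrite mem_star orbF. Qed.

(** A nonzero matrix of rank at most one has all its columns on one line, and [star U]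
    meets that line in [star [:: u]] for exactly one [u] of [U].  The zero matrix lies
    in [star [:: u]] for every [u]; it has to be counted only once, which accounts for
    the two correction terms. *)
Lemma degenerate_lines U A : uniq (star U) ->
  {in U &, forall u v, u != v -> det2 u v != 0} ->
  ((columns_in (star U) A && ~~ row_free A) + size U * columns_in (star [::]) A =
  \sum_(u <- U) columns_in (star [:: u]) A + columns_in (star [::]) A)%N.
Proof.
move=> uniqU indepU.
have uniqU' : uniq U by move: uniqU; rewrite /star /= cat_uniq => /and3P[].
have sub1 u : u \in U -> {subset star [:: u] <= star U}.
  by move=> Uu p /star1P[]->; rewrite mem_star ?opprK ?eqxx ?Uu ?orbT.
have line_degenerate u : columns_in (star [:: u]) A -> ~~ row_free A.
  move=> /forallP lineA; apply/row_free2P => -[i [j]] /eqP; apply.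
  case/star1P: (lineA i) => ->; case/star1P: (lineA j) => ->;
    by rewrite ?det2Nl ?[det2 _ (- _)]det2_swap ?det2Nl ?det20l
               ?[det2 _ 0]det2_swap ?det20l ?det2_pp ?oppr0.
rewrite columns_in0; case: (boolP [forall j, _]) => [/forallP zeroA | ].
  have all_in S : 0 \in S -> columns_in S A.
    by move=> S0; apply/forallP => j; rewrite (eqP (zeroA j)).
  rewrite all_in ?mem_star ?eqxx // (line_degenerate 0) ?all_in ?mem_star ?eqxx //.
  rewrite (eq_bigr (fun=> 1%N)) ?sum1_size ?muln1 1?addnC // => u _.
  by rewrite all_in ?mem_star ?eqxx.
rewrite negb_forall => /existsP[j nz_j]; rewrite muln0 !addn0.
have [/andP[/forallP inU degA]|notD] /= := boolP (_ && _); last first.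
  rewrite big1_seq // => u /andP[_ Uu]; apply/eqP; rewrite eqb0.
  apply: contra notD => lineA; rewrite (line_degenerate u) // andbT.
  by apply/forallP => i; rewrite (sub1 u) // (forallP lineA).
have det0 i i' : det2 (column A i) (column A i') = 0.
  by apply/eqP; apply: contraNT degA => ne0; apply/row_free2P; exists i, i'.
have dirP p : p \in star U -> p != 0 -> exists2 u, u \in U & p = u \/ p = - u.
  rewrite mem_star => /or3P[->//|Up|Up] _.
    by exists p => //; left.
  by exists (- p); rewrite ?opprK //; right.
(* The line of the nonzero column j carries all the other columns. *)
have [u Uu ju] := dirP _ (inU j) nz_j.
have on_line v : v \in U -> det2 v (column A j) = 0 -> v = u.
  move=> Uv; apply: contra_eq => nevu.
  case: ju => ->; rewrite ?[det2 _ (- _)]det2_swap ?det2Nl 1?det2_swap;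
    by rewrite ?opprK ?oppr_eq0 indepU // eq_sym.
rewrite (bigD1_seq u) //= big1_seq ?addn0 => [|v /andP[nevu Uv]].
  suff -> : columns_in (star [:: u]) A by [].
  apply/forallP => i; apply/star1P.
  have [->|nz_i] := eqVneq (column A i) 0; first exact: Or31.
  have [v Uv iv] := dirP _ (inU i) nz_i.
  have vu : v = u.
    apply: on_line => //; have := det0 i j.
    by case: iv => ->; rewrite ?det2Nl // => /eqP; rewrite oppr_eq0 => /eqP.
  by case: iv => ->; rewrite vu; [apply: Or32|apply: Or33].
apply/eqP; rewrite eqb0; apply: contra nevu => /forallP/(_ j)/star1P.
case=> jv; first by rewrite jv eqxx in nz_j.
  by apply/eqP/on_line; rewrite // jv det2_pp.
by apply/eqP/on_line; rewrite // jv det2_swap det2Nl det2_pp !oppr0.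
Qed.

(** Sum of [degenerate_lines] over all matrices: each of the lines through the
    vectors of [U] carries 3^n matrices, and they share only the zero matrix. *)
Lemma card_degenerate U : uniq (star U) ->
  {in U &, forall u v, u != v -> det2 u v != 0} ->
  (#|[set A | columns_in (star U) A & ~~ row_free A]| + size U =
     size U * 3 ^ n + 1)%N.
Proof.
move=> uniqU indepU.
have cardE (P : pred 'M[F]_(2, n)) : #|[set A | P A]| = (\sum_A P A)%N.
  by rewrite -sum1dep_card big_mkcond.
have card0 : (\sum_A columns_in (star [::]) A = 1)%N.
  by rewrite -(cardE (columns_in _)) card_columns_in ?exp1n.
have /esym : (\sum_A _)%N = (\sum_A _)%N :=
  eq_bigr _ (fun A _ => degenerate_lines A uniqU indepU).
rewrite !big_split /= card0 -big_distrr /= card0 muln1.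
rewrite -(cardE (fun A => columns_in _ A && _)) => <-.
congr addn; rewrite exchange_big /= (eq_big_seq (fun=> 3 ^ n)%N) => [|u Uu].
  by rewrite big_const_seq count_predT iter_addn_0 mulnC.
by rewrite -(cardE (columns_in _)) card_columns_in // (uniq_star1 uniqU).
Qed.

End TwoRows.

Lemma det_mx2 (F : finFieldType) (g : 'M[F]_2) :
  \det g = det2 (column g 0) (column g 1).
Proof.
by rewrite -(det_colsub2 id); congr (\det _); apply/matrixP => i j; rewrite mxE.
Qed.

Lemma act0 (F : finFieldType) (g : 'M[F]_2) : act g 0 = 0.
Proof. by rewrite /act /= !mulr0 addr0. Qed.

Lemma actN (F : finFieldType) (g : 'M[F]_2) p : act g (- p) = - act g p.
Proof. by rewrite /act /= !mulrN -!opprD. Qed.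

Lemma mem_starN (F : finFieldType) (U : seq (F * F)) p :
  (- p \in star U) = (p \in star U).
Proof.
by rewrite !mem_star oppr_eq0 opprK [(- p \in U) || _]orbC.
Qed.

(** * Vectors and bases of the plane over the field with five elements *)

Definition F5s : seq 'F_5 := [:: 0; 1; 2; 3; 4].
Definition vecs : seq ('F_5 * 'F_5) := [seq (a, b) | a <- F5s, b <- F5s].
(** Pairs of vectors stand for the columns of a 2 x 2 matrix; unlike matrices, they
    can be enumerated by evaluation. *)
Definition frames : seq (('F_5 * 'F_5) * ('F_5 * 'F_5)) :=
  [seq (v, w) | v <- vecs, w <- vecs].

Lemma mem_F5s (x : 'F_5) : x \in F5s.
Proof. by case: x => [[|[|[|[|[|m]]]]] ltm]; rewrite // !inE -!val_eqE. Qed.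

Lemma mem_vecs (p : 'F_5 * 'F_5) : p \in vecs.
Proof. by case: p => a b; apply: allpairs_f; exact: mem_F5s. Qed.

Lemma forall_vec (P : pred ('F_5 * 'F_5)) : all P vecs -> forall p, P p.
Proof. by move=> /allP allP p; apply/allP/mem_vecs. Qed.

Lemma mem_frames x : x \in frames.
Proof. by case: x => v w; apply: allpairs_f; exact: mem_vecs. Qed.

Definition frame_mx (x : ('F_5 * 'F_5) * ('F_5 * 'F_5)) : 'M['F_5]_2 :=
  \matrix_(i, j)
    let p := if j == 0 then x.1 else x.2 in if i == 0 then p.1 else p.2.

Definition frame_act (x : ('F_5 * 'F_5) * ('F_5 * 'F_5)) (p : 'F_5 * 'F_5) :=
  (x.1.1 * p.1 + x.2.1 * p.2, x.1.2 * p.1 + x.2.2 * p.2).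

Definition squares : seq 'F_5 := [:: 0; 1; - 1].

Lemma nonnegE (x : 'F_5) : nonneg x = (x \in squares).
Proof.
apply/existsP/idP => [[y /eqP->] | ].
  have /allP : all (fun y : 'F_5 => y ^+ 2 \in squares) F5s by vm_compute.
  by apply; exact: mem_F5s.
by rewrite !inE => /or3P[] /eqP->; [exists 0|exists 1|exists 2]; vm_compute.
Qed.

Definition frames_into K U :=
  [set g : 'M['F_5]_2 | g \in unitmx & all (fun u => act g u \in star U) K].

(** The right-hand side is written for evaluation: the list [star U] is computed only
    once, and equality tests and products use the structures of 'F_5 directly instead
    of those derived from its structure of finite field. *)
Lemma card_frames K U : #|frames_into K U| =
  let S : seq ('F_5 * 'F_5) := star U in
  count (fun x => (x.1.1 * x.2.2 - x.2.1 * x.1.2 != 0) &&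
                  all (fun u => frame_act x u \in S) K) frames.
Proof.
have frame_bij : bijective frame_mx.
  exists (fun g => (column g 0, column g 1)) => [[[a b] [c d]]|g].
    by rewrite /column !mxE.
  apply/matrixP => i j; rewrite mxE /=.
  by case: i j => [[|[|//]] lti] [[|[|//]] ltj]; congr (g _ _); apply/val_inj.
rewrite -(on_card_preimset (onW_bij _ frame_bij)).
cbv zeta; rewrite cardE size_filter.
have uniq_frames : uniq frames by vm_compute.
have /permP <- : perm_eq (enum {: ('F_5 * 'F_5) * ('F_5 * 'F_5)}) frames.
  apply: uniq_perm (enum_uniq _) uniq_frames _ => x.
  by rewrite mem_enum mem_frames.
rewrite enumT; apply: eq_count => x; rewrite !inE unitmxE unitfE.
have -> : \det (frame_mx x) = det2 x.1 x.2.
  by rewrite det_mx2 /column !mxE; case: x => [[a b] [c d]].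
congr andb; apply: eq_all => u.
by rewrite /act !mxE.
Qed.

Definition e1 : 'F_5 * 'F_5 := (1, 0).
Definition e2 : 'F_5 * 'F_5 := (0, 1).
Definition edge := [:: e1; e2].
Definition triangle := [:: e1; e2; e1 + e2].
(** In a normal form the columns, up to sign, are the vertices of the edge {e1, e2} or
    of one of the two triangles that contain it. *)
Definition supports := [:: edge; triangle; [:: e1; e2; e1 - e2]].

(** The two cases are 2 * 24 = 3 * 8 + 24 when [K] is the edge and 2 * 12 = 3 * 0 + 24
    when [K] is a triangle: a linear map that sends the vertices of [K] into a triangle
    or an edge of the icosahedron is determined by the images of e1 and e2. *)
Lemma frames_balance K : K \in supports ->
  (2 * #|frames_into K triangle| = 3 * #|frames_into K edge| + 24)%N.
Proof.
rewrite !card_frames => inK; apply/eqP.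
by move: K inK; apply/allP; vm_compute.
Qed.

(** * Normal forms of totally nonnegative planes *)

Definition good (n : nat) (A : 'M['F_5]_(2, n)) :=
  [forall i, forall j, nonneg (det2 (column A i) (column A j))].

Lemma goodP n (A : 'M['F_5]_(2, n)) :
  reflect (forall i j, det2 (column A i) (column A j) \in squares) (good A).
Proof.
apply: (iffP forallP) => [goodA i j|goodA i].
  by rewrite -nonnegE; have /forallP := goodA i; apply.
by apply/forallP => j; rewrite nonnegE.
Qed.

Lemma good_minors n (A : 'M['F_5]_(2, n)) :
  [forall I : ksubset 2 n, nonneg (minor I A)] = good A.
Proof.
apply: forall_minor2 => a.
by rewrite !nonnegE !inE oppr_eq0 eqr_oppLR eqr_opp [X in _ || X]orbC.
Qed.

Lemma Gr_nonneg2P n (V : {vspace 'rV['F_5]_n}) :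
  reflect (exists A : 'M['F_5]_(2, n), [/\ row_free A, rowspan A = V & good A])
          (V \in Gr_nonneg 'F_5 2 n).
Proof.
rewrite inE; apply: (iffP andP) => [[_ /existsP[A]]|[A [freeA <- goodA]]].
  by rewrite good_minors => /and3P[freeA /eqP spanA goodA]; exists A.
rewrite inE dim_rowspan // eqxx; split=> //.
by apply/existsP; exists A; rewrite good_minors freeA eqxx.
Qed.

Lemma good_triangle n (A : 'M['F_5]_(2, n)) : columns_in (star triangle) A -> good A.
Proof.
move=> /forallP inA; apply/goodP => i j.
have /allP/(_ _ (inA i))/allP/(_ _ (inA j)) : all (fun p => all (fun q =>
   det2 p q \in squares) (star triangle)) (star triangle) by vm_compute.
by [].
Qed.

Lemma triangle_indep : {in triangle &, forall u v, u != v -> det2 u v != 0}.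
Proof.
move=> u v inu inv.
have /allP/(_ u inu)/allP/(_ v inv) : all (fun u => all (fun v =>
  (u == v) || (det2 u v != 0)) triangle) triangle by vm_compute.
by case/orP=> // ->.
Qed.

Lemma edge_indep : {in edge &, forall u v, u != v -> det2 u v != 0}.
Proof.
apply: sub_in2 triangle_indep => u.
by rewrite !inE => /orP[]->; rewrite ?orbT.
Qed.

Lemma edge_triangle : {subset star edge <= star triangle}.
Proof.
move=> p; rewrite !mem_star !inE.
by case/or3P=> [->|/orP[]->|/orP[]->]; rewrite ?orbT.
Qed.

(** Multiply by the inverse of an invertible 2 x 2 submatrix.  Its determinant is 1 or
    -1, so the minors change at most by a sign. *)
Lemma normal_form n (A : 'M['F_5]_(2, n)) : row_free A -> good A ->
  exists A0 i j, [/\ row_free A0, rowspan A0 = rowspan A, good A0,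
     column A0 i = e1 & column A0 j = e2].
Proof.
move=> freeA /goodP goodA; have /row_free2P[i [j det_ij]] := freeA.
pose B := colsub (pick2 i j) A.
have detB : \det B = det2 (column A i) (column A j) by rewrite det_colsub2.
have unitB : B \in unitmx by rewrite unitmxE unitfE detB.
have B0 : colsub (pick2 i j) (invmx B *m A) = 1%:M.
  by rewrite -mulmx_colsub mulVmx.
have eqA : (invmx B *m A :=: A)%MS.
  by apply: eqmxMfull; rewrite row_full_unit unitmx_inv.
have colB (k : 'I_2) :
    column (invmx B *m A) (pick2 i j k) = ((0 == k)%:R, (1 == k)%:R).
  rewrite /column; move/matrixP: B0 => B0.
  by have := B0 0 k; have := B0 1 k; rewrite !mxE => -> ->.
exists (invmx B *m A), i, j; split.
- by rewrite /row_free eqA.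
- by apply/eqP; rewrite eq_rowspan; apply/eqmxP.
- apply/goodP => k l; rewrite det2_mulmx det_inv detB.
  have := goodA k l; have := goodA i j; move: det_ij.
  rewrite !inE => /negPf-> /= /orP[]/eqP->; rewrite ?invrN invr1 ?mul1r // mulN1r.
  by rewrite oppr_eq0 eqr_oppLR eqr_opp [X in _ || X]orbC.
- by have := colB 0.
- by have := colB 1.
Qed.

(** A vector whose determinants with e1 and e2 are 0, 1 or -1 has both coordinates in
    {0, 1, -1}. *)
Lemma compatible_third (c : 'F_5 * 'F_5) :
  det2 e1 c \in squares -> det2 c e2 \in squares ->
  c \in star edge \/ exists2 x, x \in [:: e1 + e2; e1 - e2] & c = x \/ c = - x.
Proof.
have /forall_vec/(_ c)/implyP impl : all (fun c =>
    (det2 e1 c \in squares) && (det2 c e2 \in squares) ==>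
    [|| c \in star edge, c \in [:: e1 + e2; e1 - e2]
      | - c \in [:: e1 + e2; e1 - e2]]) vecs.
  by vm_compute.
move=> det1 det2; have /or3P[] := impl (introT andP (conj det1 det2)).
- by left.
- by right; exists c => //; left.
- by right; exists (- c) => //; right; rewrite opprK.
Qed.

(** The edge {e1, e2} lies in two triangles, but their third vertices e1 + e2 and
    e1 - e2 have determinant 2 or -2, which is not a square. *)
Lemma compatible_triangle (x d c : 'F_5 * 'F_5) :
  x \in [:: e1 + e2; e1 - e2] -> d = x \/ d = - x ->
  det2 e1 c \in squares -> det2 c e2 \in squares ->
  det2 c d \in squares -> c \in star [:: e1; e2; x].
Proof.
have /forall_vec/(_ c)/allP impl : all (fun c => all (fun x => all (fun d =>
      [&& det2 e1 c \in squares, det2 c e2 \in squares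
        & det2 c d \in squares] ==>
      (c \in star [:: e1; e2; x])) [:: x; - x]) [:: e1 + e2; e1 - e2]) vecs.
  by vm_compute.
move=> /impl/allP implx eq_d det1 det2 det_d.
have /implx/implyP : d \in [:: x; - x] by case: eq_d => ->; rewrite !inE eqxx ?orbT.
by apply; rewrite det1 det2.
Qed.

Lemma normal_form_support n (A : 'M['F_5]_(2, n)) i j : good A ->
  column A i = e1 -> column A j = e2 ->
  exists2 K, K \in supports &
    columns_in (star K) A /\
    {in K, forall u, exists k, column A k = u \/ column A k = - u}.
Proof.
move=> /goodP goodA Ai Aj.
have det1 k : det2 e1 (column A k) \in squares by rewrite -Ai.
have det2 k : det2 (column A k) e2 \in squares by rewrite -Aj.
have on1 : exists k, column A k = e1 \/ column A k = - e1 by exists i; left.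
have on2 : exists k, column A k = e2 \/ column A k = - e2 by exists j; left.
case: (boolP (columns_in (star edge) A)) => [inA | ].
  exists edge; first exact: mem_head.
  by split=> // u; rewrite !inE => /orP[]/eqP->.
rewrite negb_forall => /existsP[k out_k].
have [in_k|[x xP kx]] := compatible_third (det1 k) (det2 k).
  by rewrite in_k in out_k.
exists [:: e1; e2; x].
  by move: xP; rewrite !inE => /orP[]/eqP->; rewrite eqxx ?orbT.
split.
  apply/forallP => l.
  exact: compatible_triangle xP kx (det1 l) (det2 l) (goodA l k).
by move=> u; rewrite !inE => /or3P[]/eqP-> //; exists k.
Qed.

(** Because [star U] is stable under signs and contains 0, it suffices to follow the
    vectors of [K], each of which occurs up to sign among the columns. *)
Lemma columns_in_mulmx n (A : 'M['F_5]_(2, n)) K U g :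
  columns_in (star K) A ->
  {in K, forall u, exists k, column A k = u \/ column A k = - u} ->
  columns_in (star U) (g *m A) = all (fun u => act g u \in star U) K.
Proof.
move=> /forallP inA onA; apply/forallP/allP => [inU u /onA[k Ak]|allU k].
  by have := inU k; rewrite column_mulmx; case: Ak => ->; rewrite ?actN ?mem_starN.
rewrite column_mulmx; have := inA k; rewrite mem_star => /or3P[/eqP->|/allU//|/allU].
  by rewrite act0 mem_star eqxx.
by rewrite actN mem_starN.
Qed.

Definition fibre n U (V : {vspace 'rV['F_5]_n}) :=
  [set A : 'M['F_5]_(2, n) | row_free A & (rowspan A == V) && columns_in (star U) A].

Lemma fibre_balance n (V : {vspace 'rV['F_5]_n}) : V \in Gr_nonneg 'F_5 2 n ->
  (2 * #|fibre triangle V| = 3 * #|fibre edge V| + 24)%N.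
Proof.
case/Gr_nonneg2P => A [freeA <- goodA].
have [A0 [i [j [freeA0 <- goodA0 Ai Aj]]]] := normal_form freeA goodA.
have [K inK [inA onA]] := normal_form_support goodA0 Ai Aj.
rewrite /fibre !card_rowspan_fibre //.
have cardE U :
    #|[set g | g \in unitmx & columns_in (star U) (g *m A0)]| = #|frames_into K U|.
  by apply: eq_card => g; rewrite !inE (columns_in_mulmx _ _ inA onA).
by rewrite !cardE frames_balance.
Qed.

Lemma card_full_rank n U : {subset star U <= star triangle} ->
  #|[set A : 'M['F_5]_(2, n) | columns_in (star U) A & row_free A]| =
  (\sum_(V in Gr_nonneg 'F_5 2 n) #|fibre U V|)%N.
Proof.
move=> subU; rewrite -sum1dep_card.
rewrite (partition_big (@rowspan _ 2 n) (mem (Gr_nonneg 'F_5 2 n)))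
  => [|A /andP[inU freeA]].
  apply: eq_bigr => V _; rewrite sum1dep_card; apply: eq_card => A.
  by rewrite !inE -andbA andbCA [_ && (_ == _)]andbC.
apply/Gr_nonneg2P; exists A; split=> //; apply: good_triangle.
by apply/forallP => j; apply/subU/(forallP inU).
Qed.

Lemma card_columns_split n U : uniq (star U) ->
  {in U &, forall u v, u != v -> det2 u v != 0} ->
  (#|[set A : 'M['F_5]_(2, n) | columns_in (star U) A & row_free A]|
     + size U * 3 ^ n + 1 = size (star U) ^ n + size U)%N.
Proof.
move=> uniqU indepU; rewrite -addnA -(card_degenerate n uniqU indepU) addnA; congr addn.
rewrite -card_columns_in // -[RHS](cardsID [set A | row_free A]).
by congr addn; apply: eq_card => A; rewrite !inE // andbC.
Qed.

Lemma card_Gr_nonneg n : (24 * #|Gr_nonneg 'F_5 2 n| + 3 * 5 ^ n = 2 * 7 ^ n + 1)%N.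
Proof.
have := card_columns_split n (isT : uniq (star edge)) edge_indep.
have := card_columns_split n (isT : uniq (star triangle)) triangle_indep.
rewrite !card_full_rank //; last exact: edge_triangle.
have : (2 * \sum_(V in Gr_nonneg 'F_5 2 n) #|fibre triangle V| =
   3 * (\sum_(V in Gr_nonneg 'F_5 2 n) #|fibre edge V|) + 24 * #|Gr_nonneg 'F_5 2 n|)%N.
  rewrite !big_distrr /= [(24 * _)%N]mulnC -sum_nat_const -big_split /=.
  by apply: eq_bigr => V /fibre_balance.
rewrite /=; lia.
Qed.

(** * The two numerical formulas *)

Lemma sum_pow3 (n : nat) :
  (2 * \sum_(1 <= i < n.+1) 3 ^ (n - i) + 1 = 3 ^ n)%N.
Proof.
elim: n => [|n IHn]; first by rewrite big_geq.
rewrite big_nat_recr //= subnn.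
rewrite (_ : \sum_(1 <= i < n.+1) _ = 3 * \sum_(1 <= i < n.+1) 3 ^ (n - i))%N.
  rewrite expnS; lia.
rewrite big_distrr; apply: eq_big_nat => i /andP[_ ltin].
by rewrite subSn // expnS.
Qed.

(** Increasing n by one multiplies every term with j <= n by 5, and the terms with
    j = n + 1 add the sum of [sum_pow3]. *)
Lemma sum_edges (n : nat) :
  (8 * (\sum_(1 <= i < n.+1) \sum_(i.+1 <= j < n.+1)
           3 ^ (j - i - 1) * 5 ^ (n - j)) + 2 * 3 ^ n = 5 ^ n + 1)%N.
Proof.
elim: n => [|n IHn]; first by rewrite big_geq.
rewrite big_nat_recr //= (big_geq (leqnn n.+2)) addn0.
rewrite (_ : \sum_(1 <= i < n.+1) _ =
   5 * (\sum_(1 <= i < n.+1) \sum_(i.+1 <= j < n.+1)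
           3 ^ (j - i - 1) * 5 ^ (n - j)) +
   \sum_(1 <= i < n.+1) 3 ^ (n - i))%N.
  have := sum_pow3 n; rewrite !expnS; lia.
rewrite big_distrr -big_split; apply: eq_big_nat => i /andP[_ ltin] /=.
rewrite big_nat_recr //= subnn muln1 subSn // subn1 /= big_distrr /=.
congr addn; apply: eq_big_nat => j /andP[_ ltjn].
by rewrite subSn // expnS mulnCA.
Qed.

(** Increasing n by one multiplies every term with l <= n by 7, and the terms with
    l = n + 1 add four times the sum of [sum_edges]. *)
Lemma sum_triangles (n : nat) :
  (12 * (\sum_(1 <= i < n.+1) \sum_(i.+1 <= j < n.+1) \sum_(j.+1 <= l < n.+1)
           4 * 3 ^ (j - i - 1) * 5 ^ (l - j - 1) * 7 ^ (n - l))
     + 3 * 5 ^ n + 1 = 7 ^ n + 3 * 3 ^ n)%N.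
Proof.
elim: n => [|n IHn]; first by rewrite big_geq.
rewrite big_nat_recr //= (big_geq (leqnn n.+2)) addn0.
rewrite (_ : \sum_(1 <= i < n.+1) _ =
   7 * (\sum_(1 <= i < n.+1) \sum_(i.+1 <= j < n.+1) \sum_(j.+1 <= l < n.+1)
           4 * 3 ^ (j - i - 1) * 5 ^ (l - j - 1) * 7 ^ (n - l)) +
   4 * \sum_(1 <= i < n.+1) \sum_(i.+1 <= j < n.+1)
           3 ^ (j - i - 1) * 5 ^ (n - j))%N.
  have := sum_edges n; rewrite !expnS; lia.
rewrite !big_distrr -big_split; apply: eq_big_nat => i /andP[_ ltin] /=.
rewrite big_nat_recr //= (big_geq (leqnn n.+2)) addn0.
rewrite !big_distrr -big_split; apply: eq_big_nat => j /andP[_ ltjn] /=.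
rewrite big_nat_recr //= subnn muln1 subSn // subn1 /= big_distrr /= mulnA.
congr addn; last by rewrite subn1.
apply: eq_big_nat => l /andP[_ ltln].
by rewrite subSn // expnS mulnCA.
Qed.

(** * The generating function *)

Lemma fps_inv_uniq (R : fieldType) (f g : fps R) (f0 : f 0%N != 0) :
  (forall m, fps_mul g f m = (m == 0)%N%:R) -> g =1 fps_inv f.
Proof.
move=> gf1 m; elim/ltn_ind: m => m IHm.
have := etrans (gf1 m) (esym (fps_mulVf f0 m)).
rewrite /fps_mul !big_ord_recr /= subnn.
rewrite (eq_bigr (fun i : 'I_m => fps_inv f i * f (m - i)%N)).
  by move=> /addrI /(mulIf f0).
by move=> i _; rewrite IHm.
Qed.

(** The polynomial is 1 - 13 X + 47 X^2 - 35 X^3.  The product with the closed formula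
    has to be computed by hand up to degree 2; from degree 3 on exactly four terms
    contribute, and they cancel because 1, 5 and 7 are the roots of the reciprocal
    polynomial. *)
Lemma fps_inv_cubic (m : nat) :
  fps_inv (fps_of_poly ((1 - 'X) * (1 - 5 *: 'X) * (1 - 7 *: 'X))) m =
  (2 * 7 ^+ m.+2 - 3 * 5 ^+ m.+2 + 1) / 24 :> rat.
Proof.
set p : {poly rat} := _ * _.
have pE : p = Poly [:: 1; - 13; 47; - 35].
  rewrite /p /= !cons_poly_def -!mul_polyC; ring.
have cE i : fps_of_poly p i = nth 0 [:: 1; - 13; 47; - 35] i.
  by rewrite /fps_of_poly pE coef_Poly.
symmetry; move: m; apply: fps_inv_uniq; first by rewrite cE.
move=> m; rewrite /fps_mul; case: m => [|[|[|m]]].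
- by rewrite big_ord_recr big_ord0 /= cE /=; field.
- by rewrite !big_ord_recr big_ord0 /= !cE /=; field.
- by rewrite !big_ord_recr big_ord0 /= !cE /=; field.
rewrite 4!big_ord_recr big1 /= => [|i _]; last first.
  by rewrite cE nth_default ?mulr0 //=; have := ltn_ord i; lia.
rewrite !cE (_ : m.+3 - m = 3)%N; last by lia.
rewrite (_ : m.+3 - m.+1 = 2)%N; last by lia.
rewrite (_ : m.+3 - m.+2 = 1)%N ?subnn; last by lia.
by rewrite /= !exprS; field.
Qed.

Unset Implicit Arguments.

Theorem theorem5p6 (n : nat) (hn : (2 <= n)%N) :
  [/\ #|Gr_nonneg 'F_5 2 n| =
        (\sum_(1 <= i < n.+1) \sum_(i.+1 <= j < n.+1)
           3 ^ (j - i - 1) * 5 ^ (n - j) +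
         \sum_(1 <= i < n.+1) \sum_(i.+1 <= j < n.+1) \sum_(j.+1 <= l < n.+1)
           4 * 3 ^ (j - i - 1) * 5 ^ (l - j - 1) * 7 ^ (n - l))%N,
      #|Gr_nonneg 'F_5 2 n|%:R = (2 * 7 ^+ n - 3 * 5 ^+ n + 1) / 24 :> rat
    & #|Gr_nonneg 'F_5 2 n|%:R =
        fps_inv (fps_of_poly ((1 - 'X) * (1 - 5 *: 'X) * (1 - 7 *: 'X)))
          (n - 2)%N :> rat].
Proof.
have closed : #|Gr_nonneg 'F_5 2 n|%:R = (2 * 7 ^+ n - 3 * 5 ^+ n + 1) / 24 :> rat.
  have : (24 * #|Gr_nonneg 'F_5 2 n| + 3 * 5 ^ n)%:R = (2 * 7 ^ n + 1)%:R :> rat.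
    by rewrite card_Gr_nonneg.
  by rewrite natrD [(2 * _ + 1)%:R]natrD !natrM !natrX; lra.
split=> //; last by rewrite fps_inv_cubic closed (_ : (n - 2).+2 = n)%N //; lia.
have := card_Gr_nonneg n; have := sum_edges n; have := sum_triangles n; lia.
Qed.
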